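(* For any two integers $n,m\geq 9$ with $n\equiv m\equiv 2 \pmod 7$, $$\gamma^{\infty}_{all}(P_m\boxtimes P_n)\leq \frac{mn}{7}+\frac{8}{7}(m+n-1).$$
   Context: $P_m\boxtimes P_n$ is the strong grid: vertex set $\{0,\dots,m-1\}\times\{0,\dots,n-1\}$, with $(i_1,j_1)$ adjacent to $(i_2,j_2)$ iff $\max\{|i_1-i_2|,|j_1-j_2|\}=1$. Eternal domination game (all-guards-move model): $k$ guards are placed on distinct vertices of a graph $G$ forming a dominating set; at each turn an attacker chooses a vertex, and then every guard may stay in place or move to an adjacent vertex, with no two guards ending on the same vertex, and some guard must end on the attacked vertex. $\gamma^{\infty}_{all}(G)$ is the minimum $k$ such that $k$ guards have a strategy to do this against every infinite sequence of attacks. *)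

(* Defs.v *)
From HB Require Import structures.
From mathcomp Require Import all_boot all_order all_algebra.
Set Implicit Arguments. Unset Strict Implicit. Unset Printing Implicit Defensive.

Section Eternal.
Variables (T : finType) (adj : rel T).

Definition closed_adj (u v : T) : bool := (u == v) || adj u v.

Definition dominating (D : {set T}) : bool :=
  [forall v : T, [exists u in D, closed_adj u v]].

Definition guard_move (C C' : {set T}) : bool :=
  [exists f : {ffun T -> T},
    [&& [forall x in C, forall y in C, (f x == f y) ==> (x == y)],
        f @: C == C' &
        [forall x in C, closed_adj x (f x)]]].

(* A nonempty family of k-guard dominating configurations from which every
   attack can be answered by a move staying within the family.  The
   existence of such a family is equivalent to the existence of a winning
   strategy for the defender (the game is a safety game). *)
Definition eternal_family (k : nat) (F : {set {set T}}) : bool :=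
  (F != set0) &&
  [forall C in F, [&& #|C| == k, dominating C &
     [forall v : T, [exists C' in F, (v \in C') && guard_move C C']]]].

Definition all_guards_win (k : nat) : bool :=
  [exists F : {set {set T}}, eternal_family k F].

(* gamma^infty_all(G): least k for which k guards win (#|T| always wins). *)
Definition eternal_dom_all : nat :=
  \big[minn/#|T|]_(k < #|T|.+1 | all_guards_win k) k.

End Eternal.

Definition absdiff (a b : nat) : nat := (a - b) + (b - a).

Definition strong_adj (m n : nat) : rel ('I_m * 'I_n) :=
  fun p q => maxn (absdiff p.1 q.1) (absdiff p.2 q.2) == 1.

(* Main.v *)
(** With [m = 7 a + 2] and [n = 7 b + 2], the grid is a ring around an [a * b]
    array of 7 x 7 blocks. Inside the ring, guards occupy a lattice
    [x + 2 y = r] or [x - 2 y = s] modulo 7; all four corners are occupied, and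
    so are five of the seven ring cells along each outer side of a block.
    Lattices of different kinds share one point per period, around which the six
    other guards of the first lattice can step to distinct points of the second
    with zero total displacement. Hence as many guards leave a block through a
    side as enter it, and the ring absorbs this exchange by sliding its guards
    (along two whole sides of the grid when a guard crosses a corner of a block
    diagonally). So each of the seven configurations of one kind can move to
    each of the seven of the other kind, which together cover all cells.

    A move depends only on the position modulo 7 and on whether it is in the
    ring, so the strategy is a finite table on a 9 x 9 template in which the
    inner 7 x 7 block may be followed by another copy of itself. *)
From Stdlib Require Import BinNat.
Require Import Defs.
From HB Require Import structures.
From mathcomp Require Import all_boot all_order all_algebra.
From mathcomp Require Import zify.
Import Order.TTheory GRing.Theory Num.Theory.
Set Implicit Arguments. Unset Strict Implicit.
Unset Printing Implicit Defensive.

(** * Guard moves in an arbitrary graph *)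

Section GuardMoves.
Variables (T : finType) (adj : rel T).
Implicit Types (C : {set T}).

(* Counting makes an onto response injective, so local data need only exhibit
   preimages. *)
Lemma guard_move_of_onto C C' (f : T -> T) :
    #|C| = #|C'| -> {in C', forall v, exists2 u, u \in C & f u = v} ->
    {in C, forall u, closed_adj adj u (f u)} -> guard_move adj C C'.
Proof.
move=> eqC onto near; have sC'f: C' \subset f @: C.
  by apply/subsetP=> v /onto[u Cu <-]; apply: imset_f.
have imf: f @: C = C'.
  by apply/esym/eqP; rewrite eqEcard sC'f -eqC leq_imset_card.
have injf: {in C &, injective f} by apply/imset_injP; rewrite imf eqC.
apply/existsP; exists [ffun x => f x]; apply/and3P; split.
- apply/forall_inP=> x Cx; apply/forall_inP=> y Cy; apply/implyP.
  by rewrite !ffunE => /eqP/(injf _ _ Cx Cy)->.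
- by apply/eqP; rewrite -imf; apply: eq_imset => x; rewrite ffunE.
- by apply/forall_inP=> x Cx; rewrite ffunE near.
Qed.

Lemma guard_moveP C C' : guard_move adj C C' ->
  exists f : T -> T, [/\ {in C &, injective f}, f @: C = C' &
    {in C, forall u, closed_adj adj u (f u)}].
Proof.
case/existsP=> f /and3P[/forall_inP inj /eqP imf /forall_inP near].
exists f; split=> // x y Cx Cy eqf.
by apply/eqP; have /forall_inP/(_ y Cy) := inj x Cx; rewrite eqf eqxx.
Qed.

(** Every guard retraces its step. Hence moves between two kinds of configurations need tabulating
    in one direction only. *)
Lemma guard_move_sym C C' :
  symmetric adj -> guard_move adj C C' -> guard_move adj C' C.
Proof.
move=> adjC /guard_moveP[f [injf imf near]].
(* The default is never reached on [C'], the image of [C] under [f]. *)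
pose g v := odflt v [pick u in C | f u == v].
have gK: {in C, cancel f g}.
  move=> u Cu; rewrite /g; case: pickP => [w /andP[Cw /eqP/injf]|/(_ u)].
    by move=> ->.
  by rewrite Cu eqxx.
apply: (@guard_move_of_onto _ _ g).
- by rewrite -imf card_in_imset.
- by move=> u Cu; exists (f u); [rewrite -imf imset_f | rewrite gK].
- move=> v; rewrite -imf => /imsetP[u Cu ->]; rewrite gK //.
  by have := near u Cu; rewrite /closed_adj eq_sym adjC.
Qed.

(** The guard answering an attack on [v] starts in the closed neighbourhood of [v], so domination
    needs no separate check on the tables. *)
Lemma guard_move_dominating C :
    (forall v, exists2 C' : {set T}, v \in C' & guard_move adj C C') ->
  dominating adj C.
Proof.
move=> resp; apply/forallP=> v; have [C' C'v] := resp v.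
case/guard_moveP=> f [_ imf near]; move: C'v.
by rewrite -imf => /imsetP[u Cu ->]; apply/existsP; exists u; rewrite Cu near.
Qed.

Lemma eternal_dom_all_le k (F : {set {set T}}) :
  eternal_family adj k F -> eternal_dom_all adj <= k.
Proof.
move=> Fk; have lekT: k < #|T|.+1.
  have /andP[/set0Pn[C FC] /forall_inP/(_ C FC)/and3P[/eqP<- _ _]] := Fk.
  by rewrite ltnS max_card.
have Pk: all_guards_win adj (Ordinal lekT) by apply/existsP; exists F.
have geB (s : seq 'I_#|T|.+1) i : i \in s -> all_guards_win adj i ->
    \big[minn/#|T|]_(j <- s | all_guards_win adj j) j <= i.
  elim: s => // j s IHs; rewrite inE big_cons => /predU1P[->|si] Pi.
    by rewrite Pi geq_minl.
  by case: ifP => _; rewrite ?geq_min ?IHs ?orbT.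
by apply: (geB _ (Ordinal lekT) _ Pk); rewrite mem_index_enum.
Qed.

End GuardMoves.

(** * Coordinate labels and counting *)

(** 0 and 8 label the ring, 1 to 7 the positions in a block. *)
Definition label (a i : nat) : nat :=
  if i == 0 then 0 else if i == (7 * a).+1 then 8 else (i.-1 %% 7).+1.

Lemma label_lt9 a i : label a i < 9.
Proof. by rewrite /label; do 2?case: ifP => // _; lia. Qed.

(** Possible labels of [i + 1 - k] when [i] has label [x]: next to a block lies
    the ring or another block, hence the two candidates. *)
Definition preds (k x : nat) : seq nat :=
  match k with
  | 0 => if x == 8 then [::] else if x == 7 then [:: 8; 1] else [:: x.+1]
  | 1 => [:: x]
  | _ => if x == 0 then [::] else if x == 1 then [:: 0; 7] else [:: x.-1]
  end.

(** [preds] is empty exactly when the preimage would lie off the grid. With [0 < a], the inner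
    neighbour of a ring position lies in a block. *)
Lemma label_pred a i' k :
    0 < a -> i' < (7 * a).+2 -> preds k (label a i') != [::] ->  k < 3 ->
  exists2 i, i < (7 * a).+2 &
    i + k - 1 = i' /\ label a i \in preds k (label a i').
Proof.
move=> a0; case: k => [|[|[|//]]] ltm nz _; rewrite /preds in nz *.
- exists i'.+1; move: nz; rewrite /label;
    repeat case: ifP => //; rewrite ?inE; lia.
- by exists i'; rewrite // addnK inE.
- exists i'.-1; move: nz; rewrite /label;
    repeat case: ifP => //; rewrite ?inE; lia.
Qed.

Lemma sum_label (F : nat -> nat) a :
  \sum_(i < (7 * a).+2) F (label a i) =
    F 0 + a * (\sum_(x < 7) F x.+1) + F 8.
Proof.
rewrite big_ord_recl big_ord_recr /= /label /= eqxx addnA; congr (_ + _ + _).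
rewrite (eq_bigr (fun i : 'I_(7 * a) => F (i %% 7).+1)); last first.
  by move=> i _; rewrite /bump /= add1n eqSS ltn_eqF.
elim: a => [|a IHa]; first by rewrite big_ord0.
rewrite [RHS]mulSn (_ : 7 * a.+1 = 7 * a + 7); last by lia.
rewrite -(big_mkord xpredT (fun i => F (i %% 7).+1)).
rewrite (big_cat_nat (n := 7 * a)) ?leq_addr //= big_mkord IHa addnC.
congr (_ + _); rewrite -{1}[7 * a]add0n big_addn addKn big_mkord.
by apply: eq_bigr => i _; congr (F _.+1); have := ltn_ord i; lia.
Qed.

Definition pull (a b : nat) (K : nat -> nat -> bool) :
    {set 'I_(7 * a).+2 * 'I_(7 * b).+2} :=
  [set p : 'I_(7 * a).+2 * 'I_(7 * b).+2 | K (label a p.1) (label b p.2)].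

(** A template cell has [a * b] copies inside, [a] or [b] along a side, and one at a corner. *)
Lemma card_pull a b (K : nat -> nat -> bool) :
  #|pull a b K| =
    a * b * (\sum_(x < 7) \sum_(y < 7) K x.+1 y.+1)
    + a * (\sum_(x < 7) (K x.+1 0 + K x.+1 8))
    + b * (\sum_(y < 7) (K 0 y.+1 + K 8 y.+1))
    + (K 0 0 + K 0 8 + K 8 0 + K 8 8).
Proof.
pose row x := K x 0 + b * (\sum_(y < 7) K x y.+1) + K x 8.
have ->: #|pull a b K| = \sum_(i < (7 * a).+2) row (label a i).
  rewrite -sum1dep_card big_mkcond /=.
  rewrite (eq_bigr (fun p : 'I_(7 * a).+2 * 'I_(7 * b).+2 =>
    nat_of_bool (K (label a p.1) (label b p.2)))).
    rewrite -(pair_bigA _ (fun (i : 'I__) (j : 'I__) =>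
      nat_of_bool (K (label a i) (label b j)))).
    apply: eq_bigr => i _; exact: (sum_label (fun y => K (label a i) y)).
  by move=> p _; case: (K _ _).
rewrite sum_label /row !big_split /= -big_distrr /=.
set s := \sum_(i < 7) \sum_(j < 7) _.
set l0 := \sum_(i < 7) nat_of_bool (K i.+1 0).
set l8 := \sum_(i < 7) nat_of_bool (K i.+1 8).
by rewrite !mulnDr !mulnA; lia.
Qed.

(** The displacement is [k - 1]; truncated subtraction and [insubd] keep a guard in place when it
    would step off the grid. *)
Definition shift (n k : nat) (i : 'I_n) : 'I_n := insubd i (i + k - 1).

Lemma shift_near n k (i : 'I_n) : k < 3 -> absdiff i (shift k i) <= 1.
Proof.
by rewrite /shift val_insubd /absdiff /=; case: ifP => _; lia.
Qed.

Lemma strong_closed_adj m n (p q : 'I_m * 'I_n) :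
    absdiff p.1 q.1 <= 1 -> absdiff p.2 q.2 <= 1 ->
  closed_adj (@strong_adj m n) p q.
Proof.
case: p q => [p1 p2] [q1 q2]; rewrite /closed_adj /strong_adj xpair_eqE /=.
by rewrite -!val_eqE /absdiff /=; lia.
Qed.

Lemma strong_adj_sym m n : symmetric (@strong_adj m n).
Proof. by move=> p q; rewrite /strong_adj /absdiff; lia. Qed.

(** * Templates of guard moves *)

(** A template is a 9 x 9 table read row by row, with 0 for an empty cell; the
    other entries, laid out as on a telephone keypad (5 = stay, 2 = decrease the
    first coordinate, 6 = increase the second), are the moves of the guards. *)
Definition cell (t : seq nat) (x y : nat) : nat := nth 0 t (9 * x + y).

Definition occupied (t : seq nat) (x y : nat) : bool := cell t x y != 0.

(** Whatever the actual position of a cell labelled [(x, y)], the guard that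
    move [(kx - 1, ky - 1)] would bring there is present and makes that move. *)
Definition covered (t : seq nat) (x y kx ky : nat) : bool :=
  [&& preds kx x != [::], preds ky y != [::] &
    all (fun x' => all (fun y' => cell t x' y' == (3 * kx + ky).+1)
      (preds ky y)) (preds kx x)].

Definition moves_onto (t u : seq nat) : bool :=
  all (fun x => all (fun y => occupied u x y ==>
    has (fun kx => has (covered t x y kx) (iota 0 3)) (iota 0 3))
    (iota 0 9)) (iota 0 9).

Lemma moves_ontoP t u x y : moves_onto t u -> x < 9 -> y < 9 ->
  occupied u x y -> exists kx ky, [/\ kx < 3, ky < 3 & covered t x y kx ky].
Proof.
move=> /allP tu ltx lty oxy.
have x9 : x \in iota 0 9 by rewrite mem_iota.
have y9 : y \in iota 0 9 by rewrite mem_iota.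
have /allP/(_ y y9) := tu x x9; rewrite oxy => /hasP[kx].
by rewrite mem_iota => lkx /hasP[ky]; rewrite mem_iota => lky; exists kx, ky.
Qed.

Lemma guard_move_pull a b t u :
    0 < a -> 0 < b -> moves_onto t u ->
    #|pull a b (occupied t)| = #|pull a b (occupied u)| ->
  guard_move (@strong_adj _ _) (pull a b (occupied t)) (pull a b (occupied u)).
Proof.
move=> a0 b0 tu eqC.
(* The predecessor undoes the offset that reserves 0 for empty cells. Reducing modulo 3 below bounds
   the displacement whatever the entry. *)
pose code (p : 'I_(7 * a).+2 * 'I_(7 * b).+2) :=
  (cell t (label a p.1) (label b p.2)).-1.
pose f p :=
  (shift (code p %/ 3 %% 3) p.1, shift (code p %% 3) p.2).
apply: (@guard_move_of_onto _ _ _ _ f) => // [[i' j']|p _]; last first.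
  by apply: strong_closed_adj; rewrite shift_near ?ltn_mod.
rewrite inE /= => /(moves_ontoP tu (label_lt9 _ _) (label_lt9 _ _)).
case=> kx [ky [lkx lky /and3P[px py /allP cov]]].
have [i lti [defi /cov/allP covi]] := label_pred a0 (ltn_ord i') px lkx.
have [j ltj [defj /covi/eqP cellij]] := label_pred b0 (ltn_ord j') py lky.
exists (Ordinal lti, Ordinal ltj); first by rewrite inE /occupied /= cellij.
rewrite /f /code /= cellij /=.
have -> : (3 * kx + ky) %/ 3 %% 3 = kx by lia.
have -> : (3 * kx + ky) %% 3 = ky by lia.
by congr (_, _); apply: val_inj;
  rewrite /shift val_insubd /= ?defi ?defj ltn_ord.
Qed.

Definition support (t : seq nat) : seq nat := [seq (c != 0 : nat) | c <- t].

Lemma occupied_support t x y : occupied (support t) x y = occupied t x y.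
Proof.
rewrite /occupied /cell /support; case: (ltnP (9 * x + y) (size t)) => lt_t.
  by rewrite (nth_map 0) //; case: (nth 0 t _).
by rewrite !nth_default ?size_map.
Qed.

(** Seven lattice points per block, five guards on each of two opposite sides, four corners: this
    fixes the number of guards. Sums over lists, unlike the locked big operators, evaluate by
    computation. *)
Definition balanced (t : seq nat) : bool :=
  let sum7 F := sumn (mkseq F 7) in
  let occ x y : nat := occupied t x y in
  [&& sum7 (fun x => sum7 (fun y => occ x.+1 y.+1)) == 7,
      sum7 (fun x => occ x.+1 0 + occ x.+1 8) == 10,
      sum7 (fun y => occ 0 y.+1 + occ 8 y.+1) == 10 &
      occ 0 0 + occ 0 8 + occ 8 0 + occ 8 8 == 4].

Definition covering (ts : seq (seq nat)) : bool :=
  all (fun x => all (fun y => has (fun t => occupied t x y) ts) (iota 0 9))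
    (iota 0 9).

(** The support of a move table identifies its source; its target is not stored but checked by
    [moves_onto]. *)
Definition moves_between (ss us ts : seq (seq nat)) : bool :=
  all (fun s => all (fun u =>
    has (moves_onto^~ u) [seq t <- ts | support t == s]) us) ss.

Lemma coveringP ts x y : covering ts -> x < 9 -> y < 9 ->
  exists2 t, t \in ts & occupied t x y.
Proof.
move=> /allP cov ltx lty.
have x9 : x \in iota 0 9 by rewrite mem_iota.
have y9 : y \in iota 0 9 by rewrite mem_iota.
by have /allP/(_ y y9)/hasP := cov x x9.
Qed.

Lemma card_pull_balanced a b t : balanced t ->
  #|pull a b (occupied t)| = 7 * a * b + 10 * a + 10 * b + 4.
Proof.
have sum7E F : \sum_(x < 7) F (nat_of_ord x) = sumn (mkseq F 7).
  by rewrite sumnE big_map -[iota 0 7]/(index_iota 0 7) big_mkord.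
case/and4P=> /eqP inside /eqP cols /eqP rows /eqP corners.
rewrite card_pull corners.
rewrite (sum7E (fun x => occupied t x.+1 0 + occupied t x.+1 8)) cols.
rewrite (sum7E (fun y => occupied t 0 y.+1 + occupied t 8 y.+1)) rows.
suff -> : \sum_(x < 7) \sum_(y < 7) occupied t x.+1 y.+1 = 7 by lia.
rewrite -[RHS]inside -sum7E; apply: eq_bigr => x _.
exact: (sum7E (fun y => occupied t x.+1 y.+1)).
Qed.

(** * The defenders' strategy from verified tables *)

Section Strategy.
Variables (sources targets moves : seq (seq nat)).
Hypothesis balanced_templates : all balanced (sources ++ targets).
Hypothesis sources_covering : covering sources.
Hypothesis targets_covering : covering targets.
Hypothesis source_target_moves : moves_between sources targets moves.
Variables (a b : nat).
Hypotheses (a0 : 0 < a) (b0 : 0 < b).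

Lemma guard_move_source_target s u : s \in sources -> u \in targets ->
  guard_move (@strong_adj _ _) (pull a b (occupied s)) (pull a b (occupied u)).
Proof.
move=> s_src u_tgt.
have eqC: #|pull a b (occupied s)| = #|pull a b (occupied u)|.
  by rewrite !card_pull_balanced //; apply: (allP balanced_templates);
    rewrite mem_cat ?s_src ?u_tgt ?orbT.
have /allP/(_ u u_tgt)/hasP[t + onto] :=
  allP source_target_moves s s_src.
rewrite mem_filter => /andP[/eqP supp_t _].
have eqK: pull a b (occupied s) = pull a b (occupied t).
  by apply/setP=> p; rewrite !inE -supp_t occupied_support.
by rewrite eqK; apply: guard_move_pull; rewrite -?eqK.
Qed.

(** The guards alternate between the two kinds, each of which covers every cell; the way back from a
    target reverses a tabulated move. *)
Lemma respond t x y : t \in sources ++ targets -> x < 9 -> y < 9 ->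
  exists2 u, u \in sources ++ targets & occupied u x y /\
    guard_move (@strong_adj _ _) (pull a b (occupied t)) (pull a b (occupied u)).
Proof.
move=> + ltx lty; rewrite mem_cat => /orP[t_src|t_tgt].
  have [u u_tgt oxy] := coveringP targets_covering ltx lty.
  exists u; first by rewrite mem_cat u_tgt orbT.
  by split=> //; apply: guard_move_source_target.
have [u u_src oxy] := coveringP sources_covering ltx lty.
exists u; first by rewrite mem_cat u_src.
split=> //; apply: guard_move_sym; first exact: strong_adj_sym.
exact: guard_move_source_target.
Qed.

Lemma eternal_dom_all_templates :
  eternal_dom_all (@strong_adj (7 * a).+2 (7 * b).+2)
    <= 7 * a * b + 10 * a + 10 * b + 4.
Proof.
pose conf t := pull a b (occupied t).
apply: (@eternal_dom_all_le _ _ _ [set C in map conf (sources ++ targets)]).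
have resp t v : t \in sources ++ targets -> exists2 C' : {set _},
    v \in C' & (C' \in map conf (sources ++ targets)) &&
      guard_move (@strong_adj _ _) (conf t) C'.
  move=> tT.
  have [u uT [ouv mv]] :=
    respond tT (label_lt9 a v.1) (label_lt9 b v.2).
  by exists (conf u); rewrite ?inE // map_f.
apply/andP; split.
  have [t t_src _] := coveringP sources_covering (isT : 0 < 9) (isT : 0 < 9).
  by apply/set0Pn; exists (conf t); rewrite inE map_f // mem_cat t_src.
apply/forall_inP=> C; rewrite inE => /mapP[t tT ->]; apply/and3P; split.
- by rewrite card_pull_balanced // (allP balanced_templates).
- apply: guard_move_dominating => v.
  by have [C' C'v /andP[_ mv]] := resp t v tT; exists C'.
- apply/forallP=> v; have [C' C'v /andP[C'F mv]] := resp t v tT.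
  by apply/exists_inP; exists C'; rewrite ?inE ?C'v.
Qed.

End Strategy.

(** * The concrete tables and the bound *)

Fixpoint digits (k : nat) (g : N) : seq nat :=
  if k is k'.+1 then
    rcons (digits k' (N.div g 10)) (N.to_nat (N.modulo g 10))
  else [::].

(** Row [x], column [y] of a grid is its decimal digit number [9 x + y], counted
    from the left. Inside, the [r]-th templates are [x + 2 y = r + 3] and
    [x - 2 y = r - 1] modulo 7 respectively. *)
Definition templatesA : seq N :=
  ([:: 101011111_010000001_100010000_100000010_000100001_100000101_101000001_100001001_110101111;
      101101111_000001000_110000001_000010001_100000010_100100001_100000101_101000001_101011111;
      101011111_001000000_100001001_010000001_100010000_100000011_100100001_100000101_101101111;
      101101111_000000100_101000001_000001000_110000001_100010001_100000011_100100001_101011111;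
      101011111_100100000_000000100_101000001_000001001_110000001_100010001_100000011_110110111;
      110110111_100000010_100100000_000000101_101000001_000001001_110000001_100010001_101011111;
      110101111_100010000_100000010_000100001_100000101_001000001_100001001_110000001_101011111])%num.

Definition templatesB : seq N :=
  ([:: 101011111_010000001_100001000_001000000_100000101_100100001_100000011_100010001_110101111;
      101011111_100010000_010000001_100001000_001000001_100000101_100100001_100000011_110110111;
      110110111_100000010_000010000_110000001_000001001_101000001_100000101_100100001_101011111;
      101011111_000100000_100000010_100010001_010000001_100001001_101000001_100000101_101101111;
      101101111_000000100_100100001_100000010_000010001_110000001_100001001_101000001_101011111;
      101011111_001000000_100000101_100100000_100000011_000010001_110000001_100001001_101101111;
      110101111_100001000_001000001_100000100_100100001_100000011_000010001_110000001_101011111])%num.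

(** One table for each of the 49 pairs, seven in a row for each source in [templatesA]. *)
Definition transitions : seq N :=
  ([:: 505055555_050000005_500060000_800000070_000100005_500000905_503000005_500004005_550505555;
      805057445_010000001_800090000_300000030_000400005_500000505_506000005_800007005_610506661;
      504044555_040000004_800050000_600000060_000700005_500000105_509000005_500003005_560605555;
      505055555_070000007_800010000_900000090_000300002_500000405_505000005_500006005_560505555;
      506069555_030000008_500040000_500000050_000600005_500000705_501000005_500009005_530404455;
      505055555_060000008_500070000_500000010_000900005_200000305_504000005_500005005_560505555;
      504045555_090000008_200030000_500000040_000500005_200000605_207000005_500001005_560605555;
      507405555_000001000_590000002_000030008_500000040_500500005_500000605_507000005_506061555;
      505605555_000004000_250000005_000060008_200000070_500100005_500000905_503000005_504044555;
      504504555_000007000_810000001_000090008_300000030_500400005_500000505_506000005_505055555;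
      509404455_000003000_840000004_000050005_600000060_500700005_500000105_509000005_505063555;
      505505555_000006000_570000007_000010002_900000090_500300002_500000405_505000005_505055555;
      505605555_000009000_530000005_000040008_200000050_200600005_500000705_501000005_505045555;
      504505555_000005000_260000005_000070008_200000010_200900005_200000305_504000005_505055555;
      505055555_004000000_500005002_060000008_500070000_500000015_500900005_500000305_504505555;
      505055555_007000000_200001005_090000008_200030000_500000045_500500005_500000605_504504555;
      504056955_003000000_200004008_050000008_200060000_500000075_500100005_500000905_503404445;
      505055555_006000000_800007008_010000001_800090000_300000035_500400005_500000505_505505555;
      505045555_009000000_500003005_040000004_800050000_600000062_500700005_500000105_505605555;
      505055555_005000000_500006005_070000007_200010000_900000092_500300002_500000405_505505555;
      506066755_001000000_200009005_030000008_200040000_200000055_200600005_500000705_501404555;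
      505605555_000000700_501000002_000009000_530000005_500040005_500000055_500600005_504045555;
      505904445_000000300_204000005_000005000_260000005_500070005_500000015_500900005_504046355;
      504504555_000000600_207000008_000001000_290000005_500030005_500000045_500500005_505055555;
      505605555_000000900_503000008_000004000_250000005_500060005_500000075_500100005_505045555;
      505505555_000000500_506000005_000007000_810000001_800090002_300000035_500400005_505055555;
      505704555_000000100_509000005_000003000_240000004_800050002_600000062_500700005_506066155;
      504505555_000000400_205000005_000006000_270000007_200010002_900000092_500300002_505055555;
      905066695_200300000_000000400_205000008_000006008_270000007_200010005_900000095_240340444;
      505055555_500600000_000000700_501000002_000009005_530000005_500040005_500000055_550550555;
      504044555_500900000_000000300_504000005_000005005_560000005_500070005_500000015_560660555;
      505055555_800500000_000000600_507000005_000001005_590000005_500030005_500000045_560560555;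
      506066675_800100000_000000900_503000002_000004005_550000005_500060005_500000075_560150455;
      505055555_800400000_000000500_506000002_000007005_810000001_800090002_300000035_560560555;
      504045555_500700000_000000100_509000002_000003005_240000004_800050002_600000062_560660555;
      560660555_600000060_500700000_000000108_509000008_000003008_240000004_500050005_504045555;
      560660555_900000090_200300000_000000408_205000008_000006008_270000007_200010005_504044555;
      550550555_500000050_800600000_000000705_801000005_000009005_530000005_500040005_505055555;
      560670455_800000010_800900000_000000305_804000005_000005005_560000005_500070005_505066615;
      560560555_800000040_800500000_000000602_807000005_000001005_590000005_500030005_505055555;
      560660555_800000070_800100000_000000902_503000005_000004005_550000005_500060005_505045555;
      840590444_300000030_800400000_000000502_506000005_000007005_810000001_800090002_305056635;
      560605555_800090000_300000030_000400008_500000508_006000008_200007008_510000001_504045555;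
      560605555_500050000_600000060_000700008_200000108_009000008_200003008_240000004_504044555;
      670606667_200010000_900000090_000300008_200000408_005000008_200006008_270000007_205014445;
      560605555_800040000_800000050_000600005_800000705_001000005_500009005_530000005_505045555;
      560505555_800070000_800000010_000900002_800000305_004000005_500005005_560000005_505055555;
      590404555_800030000_800000040_000500002_500000605_007000005_500001005_590000005_506035555;
      550505555_500060000_800000070_000100002_500000905_003000005_200004005_550000005_505055555])%num.

Definition grids : seq N -> seq (seq nat) := map (digits 81).

Lemma templates_balanced : all balanced (grids templatesA ++ grids templatesB).
Proof. by vm_compute. Qed.

Lemma templatesA_covering : covering (grids templatesA).
Proof. by vm_compute. Qed.

Lemma templatesB_covering : covering (grids templatesB).
Proof. by vm_compute. Qed.

Lemma transitions_between :
  moves_between (grids templatesA) (grids templatesB) (grids transitions).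
Proof. by vm_compute. Qed.

Lemma eternal_dom_all_strong_grid a b : 0 < a -> 0 < b ->
  eternal_dom_all (@strong_adj (7 * a).+2 (7 * b).+2)
    <= 7 * a * b + 10 * a + 10 * b + 4.
Proof.
exact: (eternal_dom_all_templates templates_balanced templatesA_covering
  templatesB_covering transitions_between).
Qed.

Local Open Scope ring_scope.

Theorem theorem2 (m n : nat) :
  (9 <= m)%N -> (9 <= n)%N -> m = 2 %[mod 7] -> n = 2 %[mod 7] ->
  ((eternal_dom_all (@strong_adj m n))%:R : rat)
    <= (m * n)%:R / 7%:R + 8%:R / 7%:R * (m + n - 1)%:R.
Proof.
move=> m9 n9 m2 n2.
have [a a0 defm] : exists2 a, (0 < a)%N & m = (7 * a).+2.
  by exists (m %/ 7)%N; lia.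
have [b b0 defn] : exists2 b, (0 < b)%N & n = (7 * b).+2.
  by exists (n %/ 7)%N; lia.
have bound := eternal_dom_all_strong_grid a0 b0; rewrite {}defm {}defn.
rewrite mulrAC -mulrDl ler_pdivlMr ?ltr0n // -!natrM -natrD ler_nat.
(* Both sides equal [49ab + 70a + 70b + 28]: the number of guards used is exactly the claimed
   bound. *)
by apply: leq_trans (leq_mul bound (leqnn 7)) _; nia.
Qed.
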